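(* Let $W$ be the affine Weyl group of type $\widetilde C_2$, i.e. the Coxeter group with simple generating set $S=\{r,s,t\}$ and relations $r^2=s^2=t^2=(rs)^4=(st)^4=(rt)^2=e$. Then the statement ''every rationally smooth $w\in W$ has a Grassmannian BP decomposition'' fails: there exists a rationally smooth element $w\in W$ such that $S\setminus\{x\}\notin\mathsf{BP}(w)$ for every $x\in S$.
   Context: An element $w$ of a Coxeter group is rationally smooth if the Kazhdan--Lusztig polynomial $P_{e,w}(q)$ equals $1$; equivalently, the polynomial $\sum_{v\le w}q^{\ell(v)}$ is palindromic, where $\le$ is Bruhat order and $\ell$ is length. For $J\subset S$, $W_J$ is the parabolic subgroup generated by $J$, and $W^J$ is the set of minimal-length representatives of the cosets $W/W_J$. Each $w\in W$ factors uniquely as $w=w^Jw_J$ with $w^J\in W^J$, $w_J\in W_J$. Write $\operatorname{Supp}(w)=\{s\in S\mid s\le w\}$ and $D_L(w)=\{s\in S\mid \ell(sw)<\ell(w)\}$. The decomposition $w=w^Jw_J$ is a Billey--Postnikov (BP) decomposition if $\operatorname{Supp}(w^J)\cap J\subset D_L(w_J)$; $\mathsf{BP}(w)$ is the set of $J\subset S$ for which this holds. It is Grassmannian if $J=S\setminus\{x\}$ for some $x\in S$. *)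

(* Defs.v *)
From HB Require Import structures.
From mathcomp Require Import all_boot all_order all_algebra.
From mathcomp Require Import boolp classical_sets fsbigop.

Set Implicit Arguments.
Unset Strict Implicit.
Unset Printing Implicit Defensive.
Import GRing.Theory.
Local Open Scope quotient_scope.
Local Open Scope nat_scope.

Section CoxeterGroup.

Variables (I : finType) (M : I -> I -> nat).

(* The congruence on words in the generators generated by s_i^2 = e and
   (s_i s_j)^(M i j) = e.  An entry M i j = 0 gives the trivial relation, that
   is, it stands for infinite order.  Because every generator is its own
   inverse, the monoid with this presentation is the Coxeter group. *)
Inductive cox_eq : seq I -> seq I -> Prop :=
| cox_eq_refl u : cox_eq u u
| cox_eq_sym u v : cox_eq u v -> cox_eq v u
| cox_eq_trans u v w : cox_eq u v -> cox_eq v w -> cox_eq u w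
| cox_eq_sq u v i : cox_eq (u ++ [:: i; i] ++ v) (u ++ v)
| cox_eq_braid u v i j :
    cox_eq (u ++ flatten (nseq (M i j) [:: i; j]) ++ v) (u ++ v).

Definition cox_rel : rel (seq I) := fun u v => `[< cox_eq u v >].

Lemma cox_rel_refl : reflexive cox_rel.
Proof. by move=> u; apply/asboolP; exact: cox_eq_refl. Qed.

Lemma cox_rel_sym : symmetric cox_rel.
Proof.
by move=> u v; apply/asboolP/asboolP => /cox_eq_sym.
Qed.

Lemma cox_rel_trans : transitive cox_rel.
Proof.
by move=> v u w /asboolP uv /asboolP vw; apply/asboolP; exact: cox_eq_trans vw.
Qed.

Canonical cox_equiv := EquivRel cox_rel cox_rel_refl cox_rel_sym cox_rel_trans.

Definition coxeter := {eq_quot cox_equiv}.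
HB.instance Definition _ := Choice.on coxeter.

Lemma cox_piP (u v : seq I) :
  (\pi_coxeter u = \pi_coxeter v) <-> cox_eq u v.
Proof.
split=> [/eqmodP /asboolP //|h]; by apply/eqmodP/asboolP.
Qed.

Lemma cox_eq_catl u v w : cox_eq u v -> cox_eq (w ++ u) (w ++ v).
Proof.
elim=> {u v} [u|u v _|u v x _ + _|u v i|u v i j].
- exact: cox_eq_refl.
- exact: cox_eq_sym.
- exact: cox_eq_trans.
- by rewrite !(catA w u); exact: cox_eq_sq.
- by rewrite !(catA w u); exact: cox_eq_braid.
Qed.

Lemma cox_eq_catr u v w : cox_eq u v -> cox_eq (u ++ w) (v ++ w).
Proof.
elim=> {u v} [u|u v _|u v x _ + _|u v i|u v i j].
- exact: cox_eq_refl.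
- exact: cox_eq_sym.
- exact: cox_eq_trans.
- by rewrite -!catA; exact: cox_eq_sq.
- by rewrite -!catA; exact: cox_eq_braid.
Qed.

Lemma cox_eq_cat u u' v v' :
  cox_eq u u' -> cox_eq v v' -> cox_eq (u ++ v) (u' ++ v').
Proof.
by move=> uu' vv'; exact: cox_eq_trans (cox_eq_catr v uu') (cox_eq_catl u' vv').
Qed.

Lemma cox_eq_revl u : cox_eq (rev u ++ u) [::].
Proof.
elim: u => [|i u IHu]; first exact: cox_eq_refl.
rewrite rev_cons cat_rcons; apply: cox_eq_trans IHu.
by have := cox_eq_sq (rev u) u i.
Qed.

Lemma cox_eq_revr u : cox_eq (u ++ rev u) [::].
Proof. by have := cox_eq_revl (rev u); rewrite revK. Qed.

Definition cox_mul (x y : coxeter) : coxeter := \pi_coxeter (repr x ++ repr y).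
Definition cox_one : coxeter := \pi_coxeter [::].
Definition cox_inv (x : coxeter) : coxeter := \pi_coxeter (rev (repr x)).

Lemma cox_eq_repr (u : seq I) : cox_eq (repr (\pi_coxeter u)) u.
Proof. by apply/cox_piP; rewrite reprK. Qed.

Lemma cox_mul_pi (u v : seq I) :
  cox_mul (\pi_coxeter u) (\pi_coxeter v) = \pi_coxeter (u ++ v).
Proof. by apply/cox_piP/cox_eq_cat; exact: cox_eq_repr. Qed.

Lemma cox_mulA : associative cox_mul.
Proof.
move=> x y z; apply/cox_piP.
apply: cox_eq_trans (cox_eq_catl _ (cox_eq_repr _)) _.
by rewrite catA; apply/cox_eq_sym/cox_eq_catr/cox_eq_repr.
Qed.

Lemma cox_mul1 : left_id cox_one cox_mul.
Proof.
move=> x; rewrite -[RHS]reprK; apply/cox_piP.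
exact: (cox_eq_catr (repr x) (cox_eq_repr [::])).
Qed.

Lemma cox_mulr1 : right_id cox_one cox_mul.
Proof.
move=> x; rewrite -[RHS]reprK; apply/cox_piP.
by have := cox_eq_catl (repr x) (cox_eq_repr [::]); rewrite cats0.
Qed.

Lemma cox_mulV : left_inverse cox_one cox_inv cox_mul.
Proof.
move=> x; apply/cox_piP.
exact: cox_eq_trans (cox_eq_catr _ (cox_eq_repr _)) (cox_eq_revl _).
Qed.

Lemma cox_mulrV : right_inverse cox_one cox_inv cox_mul.
Proof.
move=> x; apply/cox_piP.
exact: cox_eq_trans (cox_eq_catl _ (cox_eq_repr _)) (cox_eq_revr _).
Qed.

HB.instance Definition _ :=
  isGroup.Build coxeter cox_mulA cox_mul1 cox_mulr1 cox_mulV cox_mulrV.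

Definition sgen (i : I) : coxeter := \pi_coxeter [:: i].

Definition word (u : seq I) : coxeter := (\prod_(i <- u) sgen i)%g.

Lemma word_pi (u : seq I) : word u = \pi_coxeter u.
Proof.
elim: u => [|i u IHu]; first by rewrite /word big_nil.
by rewrite /word big_cons -/(word u) IHu; exact: cox_mul_pi.
Qed.

Lemma has_word (w : coxeter) :
  exists n, [exists u : n.-tuple I, word u == w].
Proof.
exists (size (repr w)); apply/existsP; exists (in_tuple (repr w)).
by rewrite word_pi reprK.
Qed.

Definition len (w : coxeter) : nat := ex_minn (has_word w).

Definition reflection (t : coxeter) : Prop :=
  exists i x, t = (sgen i ^ x)%g.

Inductive bruhat (u : coxeter) : coxeter -> Prop :=
| bruhat_refl : bruhat u u
| bruhat_step v t :
    bruhat u v -> reflection t -> len v < len (v * t)%g -> bruhat u (v * t)%g.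

Definition descL (w : coxeter) : {set I} := [set i | len (sgen i * w)%g < len w].
Definition descR (w : coxeter) : {set I} := [set i | len (w * sgen i)%g < len w].

Definition supp (w : coxeter) : {set I} := [set i | `[< bruhat (sgen i) w >]].

Definition parabolic (J : {set I}) (w : coxeter) : Prop :=
  exists2 u : seq I, {subset u <= J} & w = word u.

Definition minrep (J : {set I}) (w : coxeter) : Prop :=
  forall y, parabolic J y -> len w <= len (w * y)%g.

(* The factorization w = w^J w_J exists and is unique, so that u and v below
   are w^J and w_J. *)
Definition is_BP (w : coxeter) (J : {set I}) : Prop :=
  exists u v, [/\ minrep J u, parabolic J v, w = (u * v)%g
                & supp u :&: J \subset descL v].

Definition BP (w : coxeter) : {set {set I}} := [set J | `[< is_BP w J >]].

Local Open Scope ring_scope.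

(* The R-polynomials, with 'X for q.  For s a right descent of v,
     R_{u,v} = R_{us,vs}                      if s is a right descent of u,
     R_{u,v} = q R_{us,vs} + (q-1) R_{u,vs}   otherwise,
   and R_{u,e} is 1 if u = e and 0 otherwise.  The result does not depend on
   the descent that is picked, and it is 0 unless u <= v.  The recursion is on
   n = len v. *)
Fixpoint Rpoly_rec (n : nat) (u v : coxeter) : {poly int} :=
  match n, [pick i in descR v] with
  | n'.+1, Some i =>
      if i \in descR u then Rpoly_rec n' (u * sgen i)%g (v * sgen i)%g
      else 'X * Rpoly_rec n' (u * sgen i)%g (v * sgen i)%g
           + ('X - 1) * Rpoly_rec n' u (v * sgen i)%g
  | _, _ => (u == v)%:R
  end.

Definition Rpoly (u v : coxeter) : {poly int} := Rpoly_rec (len v) u v.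

(* q^n p(q^-1), for p of degree at most n *)
Definition revpoly (n : nat) (p : {poly int}) : {poly int} :=
  \poly_(i < n.+1) p`_(n - i).

(* The conditions which characterize the Kazhdan-Lusztig polynomials
   (P_{x,w})_x for a fixed w:
     P_{x,w} = 0 unless x <= w;   P_{w,w} = 1;
     deg P_{x,w} <= (l(w) - l(x) - 1) / 2 for x < w;
     q^(l(w) - l(x)) P_{x,w}(q^-1) = sum_(x <= a <= w) R_{x,a} P_{a,w}
   for x <= w.  They have exactly one solution, and Bruhat intervals are
   finite, so that the sum is an ordinary finite sum. *)
Record KL_family (w : coxeter) (P : coxeter -> {poly int}) : Prop := {
  KL_out : forall x, ~ bruhat x w -> P x = 0;
  KL_diag : P w = 1;
  KL_deg : forall x, bruhat x w -> x <> w ->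
    ((size (P x)).-1.*2 < len w - len x)%N;
  KL_inv : forall x, bruhat x w ->
    revpoly (len w - len x) (P x) =
    \sum_(a \in [set a | bruhat x a /\ bruhat a w]%classic) Rpoly x a * P a
}.

Definition is_KL_poly (x w : coxeter) (p : {poly int}) : Prop :=
  exists2 P, KL_family w P & P x = p.

Definition rationally_smooth (w : coxeter) : Prop := is_KL_poly 1%g w 1.

End CoxeterGroup.

(* The generators r, s, t are 0, 1, 2. *)
Definition C2tilde_matrix (i j : 'I_3) : nat :=
  nth 0 (nth [::] [:: [:: 1; 4; 2];
                      [:: 4; 1; 4];
                      [:: 2; 4; 1]] i) j.

(* Main.v *)
(** The witness is w = rsrstsr, whose Bruhat interval [e, w] has 32 elements with
    palindromic rank sizes 1, 3, 5, 7, 7, 5, 3, 1.  For x <= w the polynomial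
    P_{x,w} is 1 as soon as the sum of R_{x,a} over x <= a <= w is
    q^(l(w) - l(x)), which is a finite computation; so is the absence of a
    Grassmannian BP decomposition, the maximal proper parabolic subgroups being
    finite.
    Descents, lengths and Bruhat order are computed on words: by the strong
    exchange condition they are read off the parity with which a reflection
    occurs along a word, hence reduce to the word problem, which a normal form
    in the semidirect product (D_oo x D_oo) : Z/2 solves. *)
Require Import Defs.
From mathcomp Require Import all_boot all_order all_algebra.
From mathcomp Require Import boolp classical_sets fsbigop.

Set Implicit Arguments.
Unset Strict Implicit.
Unset Printing Implicit Defensive.
Import GRing.Theory.

(** * Words, lengths and reduced words *)

Section Words.

Variables (I : finType) (M : I -> I -> nat).
Local Notation W := (coxeter M).
Local Notation s := (@sgen I M).
Local Notation word := (@word I M).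
Local Open Scope group_scope.

Lemma word_nil : word [::] = 1.
Proof. by rewrite /Defs.word big_nil. Qed.

Lemma word_cons i u : word (i :: u) = s i * word u.
Proof. by rewrite /Defs.word big_cons. Qed.

Lemma word_cat u v : word (u ++ v) = word u * word v.
Proof. by rewrite /Defs.word big_cat. Qed.

Lemma word1 i : word [:: i] = s i.
Proof. by rewrite word_cons word_nil mulg1. Qed.

Lemma word_rcons u i : word (rcons u i) = word u * s i.
Proof. by rewrite -cats1 word_cat word1. Qed.

Lemma word_eqP u v : word u = word v <-> cox_eq M u v.
Proof. by rewrite !word_pi; exact: cox_piP. Qed.

Lemma wordP (x : W) : exists u, x = word u.
Proof. by exists (repr x); rewrite word_pi reprK. Qed.

Lemma sgen_sq i : s i * s i = 1.
Proof.
rewrite -word1 -word_cat -word_nil; apply/word_eqP.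
exact: (cox_eq_sq M [::] [::] i).
Qed.

Lemma sgenV i : (s i)^-1 = s i.
Proof. by apply: mulg1_eq; exact: sgen_sq. Qed.

Lemma word_rev u : word (rev u) = (word u)^-1.
Proof.
elim: u => [|i u IHu]; first by rewrite word_nil invg1.
by rewrite rev_cons word_rcons word_cons invgM IHu sgenV.
Qed.

Definition alt n i j : seq I := flatten (nseq n [:: i; j]).

Lemma word_alt n i j : word (alt n i j) = (s i * s j) ^+ n.
Proof.
elim: n => [|n IHn]; first by rewrite word_nil.
by rewrite /alt /= !word_cons -/(alt n i j) IHn mulgA expgS.
Qed.

Lemma braid_word i j : (s i * s j) ^+ M i j = 1.
Proof.
rewrite -word_alt -word_nil; apply/word_eqP.
by have := cox_eq_braid M [::] [::] i j; rewrite cats0.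
Qed.

Lemma len_word u : len (word u) <= size u.
Proof.
rewrite /len; case: ex_minnP => m _; apply.
by apply/existsP; exists (in_tuple u).
Qed.

Definition reduced u := len (word u) == size u.

Lemma exists_reduced (x : W) : exists2 u, reduced u & x = word u.
Proof.
have [n e] : {n | n = len x} by exists (len x).
move: (e); rewrite {1}/len; case: ex_minnP => m /existsP[u /eqP ux] _ nm.
by exists u; rewrite /reduced ux // size_tuple -nm e.
Qed.

Lemma len_mul (x y : W) : len (x * y) <= len x + len y.
Proof.
have [u /eqP ru ->] := exists_reduced x; have [v /eqP rv ->] := exists_reduced y.
by rewrite ru rv -size_cat -word_cat len_word.
Qed.

Lemma lenV (x : W) : len x^-1 = len x.
Proof.
suff h (y : W) : len y^-1 <= len y.
  by apply/eqP; rewrite eqn_leq h -{1}[x]invgK h.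
have [u /eqP ru ->] := exists_reduced y.
by rewrite ru -size_rev -word_rev len_word.
Qed.

Lemma len_sgen i : len (s i) <= 1.
Proof. by rewrite -word1 len_word. Qed.

(** * Reflections along a word and strong exchange *)

(* The parity of the number of letters of [u] whose deletion turns [word u]
   into [word u * t]. *)
Fixpoint inv_parity (u : seq I) (t : W) : bool :=
  if u is i :: u' then (t == s i ^ word u') (+) inv_parity u' t else false.

Lemma inv_parity_cat u v t :
  inv_parity (u ++ v) t = inv_parity u (t ^ (word v)^-1) (+) inv_parity v t.
Proof.
elim: u => //= i u ->; rewrite addbA word_cat conjgM; congr (_ (+) _ (+) _).
by rewrite -(inj_eq (@conjg_inj _ (word v)^-1)) conjgK.
Qed.

Lemma conj_alt n i j : s j ^ word (alt n i j) = s j * (s i * s j) ^+ n.*2.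
Proof.
rewrite word_alt; elim: n => [|n IHn]; first by rewrite conjg1 mulg1.
by rewrite expgSr conjgM IHn doubleS expgSr expgS conjgE invgM !sgenV !mulgA.
Qed.

(* The reflections met along (ij)^n are j(ij)^k for k < 2n; when
   (ij)^n = 1 each of them is met twice. *)
Lemma inv_parity_alt n i j t :
  inv_parity (alt n i j) t =
  \big[addb/false]_(0 <= k < n.*2) (t == s j * (s i * s j) ^+ k).
Proof.
elim: n => [|n IHn]; first by rewrite big_geq.
rewrite doubleS !big_nat_recr //= -/(alt n i j) IHn conj_alt word_cons.
rewrite conjgM.
have -> : (s i ^ s j) ^ word (alt n i j) = s j * (s i * s j) ^+ n.*2.+1.
  rewrite [s i ^ s j]conjgE sgenV conjMg conj_alt word_alt -mulgA expgSr.
  congr (_ * (_ * _)).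
  by rewrite conjgE -expgS expgSr mulKg.
by rewrite [LHS]addbC; congr (_ (+) _); rewrite addbC.
Qed.

Lemma inv_parity_braid i j t : inv_parity (alt (M i j) i j) t = false.
Proof.
rewrite inv_parity_alt -addnn (big_cat_nat (n := M i j)) ?leq_addr //=.
rewrite -{2}[M i j]add0n big_addn addnK.
under [X in _ (+) X]eq_bigr do rewrite expgnDr braid_word mulg1.
exact: addbb.
Qed.

Lemma inv_parity_sq i t : inv_parity [:: i; i] t = false.
Proof. by rewrite /= word1 word_nil conjgE mulKg conjg1 addbF addbb. Qed.

(** Inserting a relator leaves the conjugating suffix products unchanged, and the relator itself
    meets every reflection an even number of times. *)
Lemma eq_inv_parity u v : word u = word v -> inv_parity u =1 inv_parity v.
Proof.
have drop a b c t : word b = 1 -> inv_parity b =1 (fun=> false) ->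
    inv_parity (a ++ b ++ c) t = inv_parity (a ++ c) t.
  move=> wb pb; rewrite !inv_parity_cat pb addFb.
  by rewrite word_cat wb mul1g.
move=> /word_eqP; elim=> {u v} [u|u v _ IH|u v w _ IH1 _ IH2|u v i|u v i j] t //.
- by rewrite IH1.
- apply: drop => [|{}t]; last exact: inv_parity_sq.
  by rewrite word_cons word1 sgen_sq.
- apply: drop => [|{}t]; last exact: inv_parity_braid.
  by rewrite -/(alt _ i j) word_alt braid_word.
Qed.

Lemma inv_parity_del u t : inv_parity u t ->
  exists a i b, u = a ++ i :: b /\ word u * t = word (a ++ b).
Proof.
elim: u => //= i u IHu.
case: eqP => [-> _|_ /IHu[a [j [b [-> e]]]]].
  exists [::], i, u; split=> //.
  by rewrite word_cons -mulgA -conjgC mulgA sgen_sq mul1g.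
by exists (i :: a), j, b; rewrite !word_cons -mulgA e.
Qed.

Lemma reflectionJ (t x : W) : reflection t -> reflection (t ^ x).
Proof. by case=> i [y ->]; exists i, (y * x); rewrite conjgM. Qed.

Lemma reflection_sgen i : reflection (s i).
Proof. by exists i, 1; rewrite conjg1. Qed.

Lemma reflection_sq (t : W) : reflection t -> t * t = 1.
Proof. by case=> i [x ->]; rewrite -conjMg sgen_sq conj1g. Qed.

(** [t] has a palindromic word [rev v ++ i :: v]: the middle letter meets [t] once, and the two
    halves cancel because [v ++ rev v] represents the identity. *)
Lemma inv_parity_reflection u t : reflection t -> word u = t -> inv_parity u t.
Proof.
move=> [i [x e]]; have [v xv] := wordP x; subst x => ut.
have wu : word u = word (rev v ++ i :: v).
  by rewrite ut word_cat word_cons word_rev e conjgE mulgA.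
rewrite (eq_inv_parity wu) inv_parity_cat /= e eqxx addTb word_cons.
rewrite invgM conjgM conjgK sgenV conjgE sgenV mulgA sgen_sq mul1g.
have := eq_inv_parity (u := v ++ rev v) (v := [::]).
rewrite word_cat word_rev mulgV word_nil => /(_ erefl (s i)).
rewrite inv_parity_cat word_rev invgK /=.
by case: (inv_parity (rev v) _); case: (inv_parity v _).
Qed.

Lemma inv_parity_mul u v t : reflection t -> word v = word u * t ->
  inv_parity v t = ~~ inv_parity u t.
Proof.
move=> rt; have [a ta] := wordP t.
rewrite [in X in _ = X]ta -word_cat => /eq_inv_parity ->.
rewrite inv_parity_cat (inv_parity_reflection rt (esym ta)) addbT -ta conjgE invgK.
by rewrite mulgA mulgK.
Qed.

Lemma len_inv_parity u t : inv_parity u t -> len (word u * t) < len (word u).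
Proof.
have [v /eqP rv uv] := exists_reduced (word u).
rewrite (eq_inv_parity uv) uv => /inv_parity_del[a [i [b [vE ->]]]].
rewrite rv (leq_ltn_trans (len_word _)) // vE !size_cat /= addnS ltnS //.
Qed.

(** For odd parity, deleting a letter shortens a reduced word. For even parity, the parity is odd at
    [word u * t], and the first case applies there. *)
Lemma strong_exchange u t : reflection t ->
  if inv_parity u t then len (word u * t) < len (word u)
  else len (word u) < len (word u * t).
Proof.
move=> rt; case: ifP => [|pu]; first exact: len_inv_parity.
have [v uv] := wordP (word u * t).
have := @len_inv_parity v t; rewrite (inv_parity_mul rt (esym uv)) pu => /(_ isT).
by rewrite -uv -mulgA reflection_sq // mulg1.
Qed.

Lemma ltn_len_reflection u t : reflection t ->
  (len (word u * t) < len (word u)) = inv_parity u t.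
Proof.
move=> /(strong_exchange u); case: ifP => // _ h.
by apply/negbTE; rewrite -leqNgt ltnW.
Qed.

Lemma len_mul_sgen u i :
  len (word u * s i) = if inv_parity u (s i) then (len (word u)).-1
                       else (len (word u)).+1.
Proof.
have := strong_exchange u (reflection_sgen i).
have le1 x : len (x * s i) <= (len x).+1.
  by rewrite (leq_trans (len_mul _ _)) // -addn1 leq_add2l len_sgen.
case: ifP => _ h; apply/eqP; rewrite eqn_leq.
  rewrite -ltnS (ltn_predK h) h /= -ltnS (ltn_predK h).
  by have := le1 (word u * s i); rewrite -mulgA sgen_sq mulg1.
by rewrite le1.
Qed.

(** * Bruhat order and subwords *)

(** Walking down a Bruhat chain, each reflection deletes one letter of the current word, reduced or
    not. *)
Lemma bruhat_subseq (x : W) u :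
  bruhat x (word u) -> exists2 a, subseq a u & x = word a.
Proof.
move e: (word u) => y b.
elim: b u e => [u <-|v t _ IH rt lt u e]; first by exists u.
have v_e : v = word u * t by rewrite e -mulgA reflection_sq // mulg1.
have: inv_parity u t by rewrite -ltn_len_reflection // -v_e e.
case/inv_parity_del => a [i [b [uE ab]]].
have [c sc ->] := IH _ (etrans (esym ab) (esym v_e)).
exists c => //; apply: subseq_trans sc _.
by rewrite uE cat_subseq // subseq_cons.
Qed.

Lemma bruhat_trans (x y z : W) : bruhat x y -> bruhat y z -> bruhat x z.
Proof. by move=> xy; elim=> // v t _; exact: bruhat_step. Qed.

Lemma reduced_rcons u i : reduced (rcons u i) ->
  reduced u /\ len (word u) < len (word u * s i).
Proof.
rewrite /reduced word_rcons size_rcons => /eqP h.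
have := len_mul (word u) (s i); have := len_sgen i; have := len_word u.
rewrite h => l1 l2 l3.
suff -> : len (word u) = size u by [].
apply/eqP; rewrite eqn_leq l1 /= -ltnS (leq_trans l3) //.
by rewrite -addn1 leq_add2l.
Qed.

(** Right multiplication by [s i] turns a step by [t] into one by [t ^ s i]. It still goes up unless
    [t = s i], and then the right alternative for [y'] is the left one for [y' * t]. *)
Lemma bruhat_mul_sgen (x y : W) i : bruhat x y ->
  bruhat (x * s i) y \/ bruhat (x * s i) (y * s i).
Proof.
elim=> [|y' t xy IH rt lt]; first by right; exact: bruhat_refl.
case: IH => IH; first by left; exact: bruhat_step lt.
have rt' := reflectionJ (s i) rt.
have [u yu] := wordP y'.
have e : y' * t * s i = word (rcons u i) * (t ^ s i).
  by rewrite word_rcons -yu -!mulgA [t * _]conjgC.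
have := strong_exchange (rcons u i) rt'; case: ifP => [|_] h; last first.
  by right; rewrite e; apply: bruhat_step => //; rewrite word_rcons -yu.
have pt : inv_parity u t = false.
  by rewrite -ltn_len_reflection // -yu ltnNge ltnW.
move: h; rewrite -cats1 inv_parity_cat word1 conjgK pt addFb /= word_nil addbF.
rewrite conjg1 => /eqP ts; left.
suff -> : t = s i by [].
by rewrite -[t](conjgK (s i)) ts conjgE mulgV invgK mulg1.
Qed.

(** Induction on the last letter of [u]; a subword that uses this letter is handled by
    [bruhat_mul_sgen]. *)
Lemma subseq_bruhat a u : reduced u -> subseq a u -> bruhat (word a) (word u).
Proof.
elim/last_ind: u a => [|u i IH] a ru.
  by rewrite subseq0 => /eqP ->; exact: bruhat_refl.
have [ru' lt] := reduced_rcons ru; rewrite word_rcons.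
have up : bruhat (word u) (word u * s i).
  by apply: bruhat_step lt; [exact: bruhat_refl|exact: reflection_sgen].
case/lastP: a => [|a j]; first by move=> _; apply: bruhat_trans (IH _ ru' (sub0seq _)) up.
rewrite -[subseq _ _]subseq_rev !rev_rcons /=; case: eqP => [->|_].
  rewrite subseq_rev word_rcons => /(IH _ ru')/(bruhat_mul_sgen i)[] // h.
  exact: bruhat_trans h up.
by rewrite -rev_rcons subseq_rev => /(IH _ ru') h; exact: bruhat_trans h up.
Qed.


Lemma bruhat_len (x y : W) : bruhat x y -> x <> y -> len x < len y.
Proof.
elim=> // v t _ IH _ lt _; case: (eqVneq x v) => [-> //|/eqP/IH].
by move/ltn_trans; exact.
Qed.

(* Rational smoothness forces P_{x,w} = 1 for all x <= w, so that only the
   inversion formula is left of the conditions on a Kazhdan-Lusztig family. *)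
Lemma rationally_smooth_sum_Rpoly (w : W) : bruhat 1 w ->
  (forall x, bruhat x w ->
     (\sum_(a \in [set a | bruhat x a /\ bruhat a w]%classic) Rpoly x a)%R
     = ('X ^+ (len w - len x))%R) ->
  rationally_smooth w.
Proof.
move=> w1 sumR; exists (fun x => if `[< bruhat x w >] then 1%R else 0%R); last first.
  by rewrite asboolT.
split=> [x nxw|||x xw].
- by rewrite asboolF.
- by rewrite asboolT //; exact: bruhat_refl.
- move=> x xw nxw; rewrite asboolT // size_poly1 /= subn_gt0.
  exact: bruhat_len.
- rewrite asboolT //; transitivity ('X ^+ (len w - len x) : {poly int})%R.
    apply/polyP => i; rewrite coef_poly coefXn coef1 ltnS subn_eq0.
    by rewrite [(i == _)%N]eqn_leq; case: leqP.
  rewrite -sumR //; apply: eq_fsbigr => a; rewrite inE => -[_ aw].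
  by rewrite asboolT // mulr1.
Qed.

(** * Computation on words, given a solution of the word problem *)

Section WordProblem.

Variable eqw : rel (seq I).
Hypothesis eqwE : forall u v, eqw u v = (word u == word v).

(** [rev u' ++ i :: u'] spells the reflection [s i ^ word u']. *)
Fixpoint wparity (u v : seq I) : bool :=
  if u is i :: u' then eqw v (rev u' ++ i :: u') (+) wparity u' v else false.

Lemma wparityE u v : wparity u v = inv_parity u (word v).
Proof.
elim: u => //= i u ->; congr (_ (+) _).
by rewrite eqwE word_cat word_cons word_rev conjgE.
Qed.

(** Parity at a generator detects right descents, while the recursion prepends [i]; hence [rev u'],
    a word for the inverse, which has the same length. *)
Fixpoint wlen (u : seq I) : nat :=
  if u is i :: u' then
    if wparity (rev u') [:: i] then (wlen u').-1 else (wlen u').+1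
  else 0.

Lemma wlenE u : wlen u = len (word u).
Proof.
elim: u => [|i u IHu] /=.
  by apply/esym/eqP; rewrite -leqn0 len_word.
have -> : word (i :: u) = (word (rev u) * s i)^-1.
  by rewrite invgM sgenV word_rev invgK word_cons.
by rewrite lenV len_mul_sgen IHu wparityE word1 word_rev lenV.
Qed.

Fixpoint subwords (u : seq I) : seq (seq I) :=
  if u is i :: u' then subwords u' ++ map (cons i) (subwords u')
  else [:: [::]].

Lemma mem_subwords a u : (a \in subwords u) = subseq a u.
Proof.
elim: u a => [|i u IHu] a; first by rewrite inE subseq0.
rewrite mem_cat IHu; case: a => [|j a]; first by rewrite !sub0seq.
have inj : injective (cons i) by move=> b c [].
rewrite /=; case: eqP => [->|ne]; last first.
  by rewrite orbC; case: mapP => // -[b _ [/ne]].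
rewrite (mem_map inj) IHu; case: (boolP (subseq (i :: a) u)) => //= h.
by rewrite (subseq_trans (subseq_cons a i) h).
Qed.

Definition wbruhat u v := has (eqw u) (subwords v).

Lemma wbruhatP u v : reduced v -> reflect (bruhat (word u) (word v)) (wbruhat u v).
Proof.
move=> rv; apply: (iffP hasP) => [[a]|/bruhat_subseq[a av e]].
  by rewrite mem_subwords eqwE => av /eqP ->; exact: subseq_bruhat.
by exists a; rewrite ?mem_subwords // eqwE e.
Qed.

(** Polynomials are handled as coefficient lists, constant term first. *)
Fixpoint addp (p q : seq int) : seq int :=
  match p, q with
  | [::], _ => q
  | _, [::] => p
  | a :: p', b :: q' => (a + b)%R :: addp p' q'
  end.

Lemma Poly_addp p q : (Poly (addp p q) = Poly p + Poly q)%R.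
Proof.
elim: p q => [|a p IHp] [|b q] /=; rewrite ?add0r ?addr0 //.
by rewrite !cons_poly_def IHp polyCD mulrDl addrACA.
Qed.

Arguments addp : simpl never.

(** [letters] stands for [enum I], so that an explicit list can be substituted before evaluation;
    its first descent is then the one that [pick] returns in [Rpoly_rec]. *)
Fixpoint wRpoly (letters : seq I) n u v : seq int :=
  match n, [seq i <- letters | wparity v [:: i]] with
  | n'.+1, i :: _ =>
      if wparity u [:: i] then wRpoly letters n' (rcons u i) (rcons v i)
      else let p := wRpoly letters n' u (rcons v i) in
           addp (0%R :: wRpoly letters n' (rcons u i) (rcons v i))
                (addp (0%R :: p) (map -%R%R p))
  | _, _ => if eqw u v then [:: 1%R] else [::]
  end.

Lemma wRpolyE n u v :
  Poly (wRpoly (enum I) n u v) = Rpoly_rec n (word u) (word v).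
Proof.
have descE a i : (i \in descR (word a)) = wparity a [:: i].
  by rewrite inE ltn_len_reflection ?wparityE ?word1 //; exact: reflection_sgen.
have PolyX p : Poly (0%R :: p) = ('X * Poly p)%R.
  by rewrite /= cons_poly_def addr0 commr_polyX.
have PolyN p : Poly (map -%R%R p) = (- Poly p)%R :> {poly int}.
  by elim: p => [|c p IHp] /=; rewrite ?oppr0 // !cons_poly_def IHp polyCN mulNr opprD.
elim: n u v => [|n IHn] u v /=.
  by rewrite eqwE; case: eqP => _ /=; rewrite ?cons_poly_def ?mul0r ?add0r.
have -> : [pick i in descR (word v)] = ohead [seq i <- enum I | wparity v [:: i]].
  rewrite enumT; congr ohead; apply: eq_filter => i; exact: descE.
case: filter => [|i r] /=.
  by rewrite eqwE; case: eqP => _ /=; rewrite ?cons_poly_def ?mul0r ?add0r.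
rewrite descE; case: ifP => _; first by rewrite IHn !word_rcons.
rewrite Poly_addp PolyX Poly_addp PolyX PolyN !IHn !word_rcons.
by rewrite mulrBl mul1r.
Qed.

(** That these words represent every element below [w] is tested in [smooth_check]. *)
Definition interval (w : seq I) : seq (seq I) :=
  foldr (fun a l => if has (eqw a) l || (wlen a != size a) then l else a :: l)
    [::] (subwords w).

Lemma interval_uniq w : uniq (map word (interval w)).
Proof.
rewrite /interval; elim: (subwords w) => //= a r IHr.
case: ifP => //= /negbT; rewrite negb_or => /andP[nl _]; rewrite IHr andbT.
apply: contra nl => /mapP[b bl e]; apply/hasP; exists b => //.
by rewrite eqwE e.
Qed.

Lemma mem_interval w a : a \in interval w -> reduced a /\ subseq a w.
Proof.
rewrite -mem_subwords /interval; elim: (subwords w) => //= b r IHr.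
rewrite inE; case: ifP => [_ /IHr[? ->]|/negbT]; first by rewrite orbT.
rewrite negb_or negbK wlenE => /andP[_ rb]; rewrite inE => /orP[/eqP ->|/IHr[? ->]].
  by rewrite eqxx.
by rewrite orbT.
Qed.

(** The range covers both the list, which may end in zeros, and the index [n]. *)
Definition is_Xn n (p : seq int) :=
  all (fun i => nth 0%R p i == (i == n)%:R%R) (iota 0 (size p + n.+1)).

Lemma is_XnP n p : is_Xn n p -> Poly p = 'X^n%R.
Proof.
move=> /allP h; apply/polyP => i; rewrite coef_Poly coefXn.
case: (ltnP i (size p + n.+1)) => [lt|]; first by apply/eqP/h; rewrite mem_iota.
rewrite addnS => lt; rewrite nth_default ?gtn_eqF //.
  by rewrite (leq_trans _ lt) // ltnS leq_addl.
by rewrite (leq_trans _ (ltnW lt)) ?leq_addr.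
Qed.

Definition wsum_Rpoly letters (l : seq (seq I)) (b : seq I) : seq int :=
  foldr (fun a p => addp (wRpoly letters (size a) b a) p) [::]
    [seq a <- l | wbruhat b a].

Definition smooth_check letters w :=
  let l := interval w in
  [&& wlen w == size w,
      all (fun a => has (eqw a) l) (subwords w)
    & all (fun b => is_Xn (size w - size b) (wsum_Rpoly letters l b)) l].

Lemma smooth_checkP w :
  smooth_check (enum I) w -> rationally_smooth (word w).
Proof.
rewrite /smooth_check wlenE => /and3P[rw /allP sub /allP sum].
have inP x : bruhat x (word w) -> exists2 b, b \in interval w & x = word b.
  move=> /bruhat_subseq[a]; rewrite -mem_subwords => /sub/hasP[b bl].
  by rewrite eqwE => /eqP ab ->; exists b.
apply: rationally_smooth_sum_Rpoly => [|x xw].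
  by rewrite -word_nil; apply: subseq_bruhat; rewrite ?sub0seq.
have [b bl xb] := inP x xw; have [rb _] := mem_interval bl.
rewrite xb (eqP rw) (eqP rb) -(is_XnP (sum b bl)) /wsum_Rpoly.
pose l := map word [seq a <- interval w | wbruhat b a].
have -> : [set a | bruhat (word b) a /\ bruhat a (word w)]%classic = [set` l]%classic.
  apply/seteqP; split=> [y /= [ba yw]|y /= /mapP[a]].
    have [a al ya] := inP y yw; rewrite ya in ba *; have [ra _] := mem_interval al.
    apply/mapP; exists a => //; rewrite mem_filter al andbT.
    by exact/wbruhatP.
  rewrite mem_filter => /andP[ba al] ->; have [ra aw] := mem_interval al.
  by split; [exact/wbruhatP|exact: subseq_bruhat].
rewrite -fsbig_seq; last first.
  by apply: subseq_uniq (interval_uniq w); apply/map_subseq/filter_subseq.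
rewrite /l big_map.
have: all (mem (interval w)) [seq a <- interval w | wbruhat b a].
  by apply/allP => a; rewrite mem_filter => /andP[].
elim: [seq _ <- _ | _] => [|a r IHr]; first by rewrite big_nil.
move=> /= /andP[/mem_interval[ra _] /IHr IH]; rewrite big_cons IH Poly_addp wRpolyE.
by rewrite /Rpoly (eqP ra).
Qed.

(** * Refuting BP decompositions *)

Fixpoint words_upto (K : seq I) n : seq (seq I) :=
  if n is n'.+1 then [::] :: [seq i :: a | i <- K, a <- words_upto K n']
  else [:: [::]].

(* [D] lists the words for the elements of a finite parabolic subgroup; the
   two alternatives say that [w d^-1] is not a minimal representative, or has
   a letter that violates the support condition. *)
Definition noBP_check (K : seq I) n w :=
  let D := words_upto K n in
  all (fun i => all (fun d => has (eqw (i :: d)) D) D) K &&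
  all (fun d =>
    has (fun i => wparity (w ++ rev d) [:: i]) K ||
    has (fun a => [&& eqw a (w ++ rev d), wlen a == size a &
      has (fun i => (i \in a) && (wlen d <= wlen (i :: d))) K]) (subwords w)) D.

Lemma noBP_checkP (J : {set I}) K n w :
  J =i K -> noBP_check K n w -> J \notin BP (word w).
Proof.
move=> JK; rewrite /noBP_check => /andP[/allP clos /allP bad].
rewrite inE; apply/negP => /asboolP[u [v [um [b bJ ->] wE sub]]].
(* The list contains the empty word and is closed in the group under left multiplication by letters
   of [K], so it exhausts the parabolic subgroup. *)
have [d dD bd] : exists2 d, d \in words_upto K n & word b = word d.
  elim: b bJ {wE sub} => [|i b IHb] bJ.
    by exists [::] => //; case: (n) => [|m]; rewrite inE eqxx.
  have [j jb|d dD bd] := IHb; first by apply: bJ; rewrite inE jb orbT.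
  have iK : i \in K by rewrite -JK bJ ?mem_head.
  have /hasP[d' d'D] := allP (clos i iK) d dD.
  by rewrite eqwE => /eqP dd'; exists d'; rewrite // word_cons bd -word_cons.
have uE : u = word (w ++ rev d) by rewrite word_cat word_rev wE bd mulgK.
case/orP: (bad d dD) => /hasP[].
  move=> i iK; rewrite wparityE word1 => p.
  have := um (s i); rewrite uE leqNgt len_inv_parity // => h.
  suff: false by [].
  by apply: h; exists [:: i]; rewrite ?word1 // => j; rewrite inE JK => /eqP ->.
move=> a _ /and3P[]; rewrite eqwE wlenE => /eqP au ra /hasP[i iK /andP[ia]].
rewrite !wlenE leqNgt => /negP[].
have : i \in supp u :&: J.
  rewrite !inE JK iK andbT; apply/asboolP; rewrite uE -au -word1.
  by apply: subseq_bruhat; rewrite // sub1seq.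
by move/(fintype.subsetP sub); rewrite inE bd word_cons.
Qed.

End WordProblem.

End Words.

(** * Integer powers and dihedral normal forms *)

Section IntegerPower.

Variable G : groupType.
Local Open Scope group_scope.

Definition zpow (x : G) (n : int) : G :=
  match n with Posz m => x ^+ m | Negz m => x ^- m.+1 end.

Lemma zpowS x n : zpow x (n + 1)%R = zpow x n * x.
Proof.
case: n => [m|[|m]].
  by rewrite -[(m%:Z + 1)%R]/(Posz (m + 1)) addn1 /= expgSr.
  by rewrite /= mulVg.
have -> : (Negz m.+1 + 1)%R = Negz m by rewrite !NegzE -addn1 PoszD opprD addrNK.
by rewrite /= [x ^+ m.+2]expgS invgM mulgVK.
Qed.

Lemma zpowB x n : zpow x (n - 1)%R = zpow x n * x^-1.
Proof. by rewrite -{2}[n](subrK 1%R) zpowS mulgK. Qed.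

Lemma commute_zpow (x y : G) n : commute x y -> commute x (zpow y n).
Proof.
by case: n => m xy /=; [exact: commuteX|apply/commuteV/commuteX].
Qed.

(* [(a, e)] encodes the element (xy)^a x^e of a dihedral group generated by two
   involutions; [flip] and [shift] are right multiplication by x and y. *)
Definition dihedral := (int * bool)%type.

Definition flip (p : dihedral) : dihedral := (p.1, ~~ p.2).
Definition shift (p : dihedral) : dihedral :=
  ((if p.2 then p.1 + 1 else p.1 - 1)%R, ~~ p.2).

Lemma flipK : involutive flip.
Proof. by case=> a e; rewrite /flip /= negbK. Qed.

Lemma shiftK : involutive shift.
Proof. by case=> a []; rewrite /shift /= ?addrK ?subrK. Qed.

Definition dih (x y : G) (p : dihedral) : G :=
  zpow (x * y) p.1 * (if p.2 then x else 1).

Lemma dih_flip x y p : x * x = 1 -> dih x y (flip p) = dih x y p * x.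
Proof. by case: p => a [] xx; rewrite /dih /= ?mulg1 // -mulgA xx mulg1. Qed.

Lemma dih_shift x y p : x * x = 1 -> y * y = 1 ->
  dih x y (shift p) = dih x y p * y.
Proof.
case: p => a [] xx yy; rewrite /dih /= ?mulg1 ?zpowS ?mulgA // zpowB invgM.
by rewrite (mulg1_eq xx) (mulg1_eq yy) -!mulgA xx mulg1.
Qed.

Lemma commute_dih (z x y : G) p :
  commute z x -> commute z y -> commute z (dih x y p).
Proof.
move=> zx zy; apply: commuteM; first by apply/commute_zpow/commuteM.
by case: p.2 => //; exact: commute1.
Qed.

End IntegerPower.

(** * The word problem in type C~_2 *)

(* The normal form of the Coxeter group of type C~_2: it is the semidirect
   product of two commuting infinite dihedral groups <r, sts> and <srs, t>
   with <s>, which exchanges them. *)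
Definition C2_state := (dihedral * dihedral * bool)%type.

(** A letter to the right of s moves across it by sr = (srs)s and st = (sts)s, where srs lies in the
    second dihedral factor and sts in the first. *)
Definition C2_step (g : C2_state) (i : 'I_3) : C2_state :=
  let: (p, q, c) := g in
  match val i with
  | 0 => if c then (p, flip q, c) else (flip p, q, c)
  | 1 => (p, q, ~~ c)
  | _ => if c then (shift p, q, c) else (p, shift q, c)
  end.

Definition C2_nf (u : seq 'I_3) : C2_state :=
  foldl C2_step ((0%R, false), (0%R, false), false) u.

Definition C2_eqw : rel (seq 'I_3) := fun u v => C2_nf u == C2_nf v.

Definition gen_r : 'I_3 := @Ordinal 3 0 isT.
Definition gen_s : 'I_3 := @Ordinal 3 1 isT.
Definition gen_t : 'I_3 := @Ordinal 3 2 isT.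

Lemma enum_I3 : enum 'I_3 = [:: gen_r; gen_s; gen_t].
Proof. by apply: (inj_map val_inj); rewrite val_enum_ord. Qed.

(** Letters act on states from the right, and each relator acts trivially. *)
Lemma cox_eq_C2_nf u v : cox_eq C2tilde_matrix u v -> C2_nf u = C2_nf v.
Proof.
have drop a b c : (forall g, foldl C2_step g b = g) ->
    C2_nf (a ++ b ++ c) = C2_nf (a ++ c).
  by move=> h; rewrite /C2_nf !foldl_cat h.
elim=> {u v} [u|u v _|u v w _ -> _|u v i|u v i j] //; apply: drop.
  move=> [[p q] []]; case: i => [[|[|[|i]]] ?] //=; by rewrite ?flipK ?shiftK.
by move=> [[p q] []]; case: i => [[|[|[|i]]] ?] //; case: j => [[|[|[|j]]] ?] //=;
  rewrite ?(flipK, shiftK).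
Qed.

Section C2Word.

Local Open Scope group_scope.
Local Notation word := (@word _ C2tilde_matrix).
Local Notation s := (@sgen _ C2tilde_matrix).

Lemma commute_gen_r_gen_t : commute (s gen_r) (s gen_t).
Proof.
have := braid_word C2tilde_matrix gen_r gen_t.
rewrite [C2tilde_matrix _ _]/= expg2 => /mulg1_eq.
by rewrite invgM !sgenV.
Qed.

(** The element (is)^2 = i(sis) has square e, so it equals its inverse (sis)i. *)
Lemma commute_conj_gen_s (i : 'I_3) : C2tilde_matrix i gen_s = 4 ->
  commute (s i) (s i ^ s gen_s).
Proof.
move=> m4; have := braid_word C2tilde_matrix i gen_s.
rewrite m4 (expgnDr _ 2 2) => /mulg1_eq.
by rewrite expg2 !invgM conjgE !sgenV /commute !mulgA => <-.
Qed.

Definition C2_elt (g : C2_state) : coxeter C2tilde_matrix :=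
  dih (s gen_r) (s gen_t ^ s gen_s) g.1.1 * dih (s gen_r ^ s gen_s) (s gen_t) g.1.2
  * (if g.2 then s gen_s else 1).

(** Two cases cross the second factor, generated by srs and t: r does so when no s is present, and
    sts when t moves across s. Both r and sts commute with srs and t. *)
Lemma C2_elt_step g i : C2_elt (C2_step g i) = C2_elt g * s i.
Proof.
have sq := @sgen_sq _ C2tilde_matrix.
have sqJ j : s j ^ s gen_s * s j ^ s gen_s = 1 by rewrite -conjMg sq conj1g.
have swap j : s j ^ s gen_s * s gen_s = s gen_s * s j.
  by rewrite [LHS]conjgC -conjgM sq conjg1.
have rt := commute_gen_r_gen_t.
have : commute (s gen_r ^ s gen_s) (s gen_t ^ s gen_s) by rewrite /commute -!conjMg rt.
move: (@commute_conj_gen_s gen_r erefl) (@commute_conj_gen_s gen_t erefl).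
move: (sqJ gen_r) (sqJ gen_t) (swap gen_r) (swap gen_t); rewrite /C2_elt.
move: (s gen_r ^ s gen_s) (s gen_t ^ s gen_s) => r' t' r'r' t't' r's t's rr' tt' r't'.
case: g => [[p q] c]; case: i => [[|[|[|i]]] lti] //.
- rewrite (_ : Ordinal lti = gen_r); last exact: val_inj.
  case: c; rewrite /= dih_flip ?mulg1 //.
    by rewrite -[in RHS]mulgA -r's !mulgA.
  rewrite -[LHS]mulgA -[RHS]mulgA; congr (_ * _).
  exact: commute_dih.
- rewrite (_ : Ordinal lti = gen_s); last exact: val_inj.
  by case: c; rewrite /= mulg1 // -[RHS]mulgA sq mulg1.
- rewrite (_ : Ordinal lti = gen_t); last exact: val_inj.
  case: c; rewrite /= dih_shift ?mulg1 //; last exact: mulgA.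
  have := commute_dih q (commute_sym r't') (commute_sym tt').
  move: (dih _ _ p) (dih _ _ q) => x y t'y.
  by rewrite -[RHS]mulgA -t's !mulgA -[x * t' * y]mulgA t'y !mulgA.
Qed.

Lemma word_C2_nf u : word u = C2_elt (C2_nf u).
Proof.
have: forall g, C2_elt g * word u = C2_elt (foldl C2_step g u).
  elim: u => [|i u IHu] g; first by rewrite word_nil mulg1.
  by rewrite word_cons mulgA -C2_elt_step IHu.
by move=> <-; rewrite /C2_elt /dih /= !mulg1 mul1g.
Qed.

Lemma C2_eqwE u v : C2_eqw u v = (word u == word v).
Proof.
apply/eqP/eqP => [e|/word_eqP]; last exact: cox_eq_C2_nf.
by rewrite !word_C2_nf e.
Qed.

End C2Word.

(** * The counterexample *)

Definition bad_word := [:: gen_r; gen_s; gen_r; gen_s; gen_t; gen_s; gen_r].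

Lemma smooth_bad_word : smooth_check C2_eqw (enum 'I_3) bad_word.
Proof. by rewrite enum_I3; vm_compute. Qed.

(** The bound 4 is the largest length in a maximal proper parabolic subgroup: these are dihedral of
    order 8, 8 and 4. *)
Lemma noBP_bad_word (x : 'I_3) :
  noBP_check C2_eqw [seq i <- enum 'I_3 | i != x] 4 bad_word.
Proof.
suff: all (fun y => noBP_check C2_eqw [seq i <- enum 'I_3 | i != y] 4 bad_word)
          (enum 'I_3).
  by move/allP; apply; rewrite mem_enum.
by rewrite enum_I3; vm_compute.
Qed.

Theorem theorem1p10 :
  exists w : coxeter C2tilde_matrix,
    rationally_smooth w /\ forall x : 'I_3, [set~ x] \notin BP w.
Proof.
exists (word C2tilde_matrix bad_word); split=> [|x].
  exact: (smooth_checkP C2_eqwE smooth_bad_word).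
apply: (noBP_checkP C2_eqwE _ (noBP_bad_word x)) => i.
by rewrite in_setC1 mem_filter mem_enum andbT.
Qed.
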